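(* Let $F$ be a finite poset and $\alpha$ any signature. Then $F\vDash\chi(\mathbb{T}_\alpha)$ if and only if $F$ is $\alpha$-connected.
   Context: A signature is either the empty signature $\epsilon$ or $\alpha=n_1^{m_1}\cdots n_k^{m_k}$ with integers $n_1>\cdots>n_k\geq1$, $m_i\geq1$. Its length is $|\alpha|=m_1+\cdots+m_k$ ($|\epsilon|=0$), and $\alpha(1)\geq\alpha(2)\geq\cdots\geq\alpha(|\alpha|)$ is the sequence listing each $n_i$ exactly $m_i$ times. The starlike tree $\mathbb{T}_\alpha$ is the poset consisting of a root together with, for each $i$, $m_i$ chains of $n_i$ elements, pairwise disjoint and incomparable and all above the root; $\mathbb{T}_\epsilon$ is a single point. For a finite rooted poset $Q$, $\chi(Q)$ is its Jankov–Fine formula: a poset $F$ validates $\chi(Q)$ (intuitionistic Kripke semantics) iff there is no surjective p-morphism from an upward-closed subset of $F$ onto $Q$. The height of a poset is $\sup\{|X|-1: X \text{ a chain}\}$. For $x\in F$, ${\uparrow}^{\circ}x=\{y\in F: y>x\}$. For a poset $G$ and signature $\alpha\neq\epsilon$, an $\alpha$-partition of $G$ is a partition $G=C_1\sqcup\cdots\sqcup C_{|\alpha|}$ into upward-closed sets such that $C_j$ has height at least $\alpha(j)-1$ for each $j$; $G$ has an $\epsilon$-partition iff $G=\varnothing$. A poset $F$ is $\alpha$-connected if there is no $x\in F$ such that ${\uparrow}^{\circ}x$ has an $\alpha$-partition. *)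

(* Defs.v *)
From HB Require Import structures.
From mathcomp Require Import all_boot all_order ssralg ssrnum ssrint.
Set Implicit Arguments.
Unset Strict Implicit.
Unset Printing Implicit Defensive.
Import Order.TTheory GRing.Theory Num.Theory.

Local Open Scope order_scope.

Inductive formula : Type :=
  | Var of nat
  | Bot
  | And of formula & formula
  | Or of formula & formula
  | Imp of formula & formula.

Definition Top : formula := Imp Bot Bot.
Definition Iff (p q : formula) : formula := And (Imp p q) (Imp q p).

Fixpoint forces d (F : porderType d) (V : nat -> F -> Prop) (x : F)
    (p : formula) : Prop :=
  match p with
  | Var n => V n x
  | Bot => False
  | And p q => forces V x p /\ forces V x q
  | Or p q => forces V x p \/ forces V x q
  | Imp p q => forall y : F, x <= y -> forces V y p -> forces V y q
  end.

Definition persistent d (F : porderType d) (V : nat -> F -> Prop) : Prop :=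
  forall n (x y : F), x <= y -> V n x -> V n y.

Definition validates d (F : porderType d) (p : formula) : Prop :=
  forall V : nat -> F -> Prop, persistent V -> forall x : F, forces V x p.

Definition upset d (Q : finPOrderType d) (U : {set Q}) : bool :=
  [forall x in U, forall y, (x <= y) ==> (y \in U)].

Definition upset_imp d (Q : finPOrderType d) (U W : {set Q}) : {set Q} :=
  [set x | [forall y, (x <= y) ==> (y \in U) ==> (y \in W)]].

(* The Jankov-Fine formula of a finite rooted poset Q, in Jankov's form: the
   diagram of the finite subdirectly irreducible Heyting algebra of upsets of
   Q, with a variable p_U for each upset U, implies the variable of its second
   greatest element Q \ {root}.  A poset F validates it iff no upset of F maps
   p-morphically onto Q. *)
Definition upset_var d (Q : finPOrderType d) (U : {set Q}) : formula :=
  Var (enum_rank U).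

Definition upset_diagram d (Q : finPOrderType d) : formula :=
  And (Iff (upset_var (set0 : {set Q})) Bot)
  (\big[And/Top]_(U : {set Q} | upset U) \big[And/Top]_(W : {set Q} | upset W)
     And (Iff (upset_var (U :&: W)) (And (upset_var U) (upset_var W)))
    (And (Iff (upset_var (U :|: W)) (Or (upset_var U) (upset_var W)))
         (Iff (upset_var (upset_imp U W))
              (Imp (upset_var U) (upset_var W))))).

Definition jankov_fine d (Q : finBPOrderType d) : formula :=
  Imp (upset_diagram Q) (upset_var [set~ (\bot : Q)]).

(* The signature n_1^{m_1} ... n_k^{m_k} is the list of pairs (n_i, m_i); the
   empty list is the empty signature. *)
Definition is_signature (s : seq (nat * nat)) : bool :=
  sorted gtn (unzip1 s) && all (fun p => (0 < p.1)%N && (0 < p.2)%N) s.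

Definition signature : Type := {s : seq (nat * nat) | is_signature s}.

Definition sig_length (a : signature) : nat := sumn (unzip2 (val a)).

(* Entries are indexed from 0: [sig_nth a j] is the entry alpha(j+1). *)
Definition sig_nth (a : signature) (j : nat) : nat :=
  nth 0%N (flatten [seq nseq p.2 p.1 | p <- val a]) j.

(* [None] is the root, and [Some (Tagged _ i)], with i in the j-th ordinal
   type, is the i-th element from the bottom of the j-th chain. *)
Definition starlike (a : signature) : Type :=
  option {j : 'I_(sig_length a) & 'I_(sig_nth a j)}.

Section StarlikeOrder.
Variable a : signature.

HB.instance Definition _ := Finite.copy (starlike a)
  (option {j : 'I_(sig_length a) & 'I_(sig_nth a j)}).

Definition starlike_le (u v : starlike a) : bool :=
  match u, v with
  | None, _ => true
  | Some _, None => false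
  | Some p, Some q => (tag p == tag q) && (tagged p <= tagged q)%N
  end.

Lemma starlike_le_refl : reflexive starlike_le.
Proof. by case=> [p|] //=; rewrite eqxx leqnn. Qed.

Lemma starlike_le_anti : antisymmetric starlike_le.
Proof.
case=> [[j i]|] [[j' i']|] //= /andP[/andP[/eqP e h] /andP[_ h']].
case: j' / e i' h h' => i' h h'.
by congr (Some (Tagged _ _)); apply/val_inj/anti_leq; rewrite h.
Qed.

Lemma starlike_le_trans : transitive starlike_le.
Proof.
case=> [q|] [p|] [r|] //= /andP[/eqP e h] /andP[/eqP e' h'].
by apply/andP; split; [apply/eqP/(etrans e) | apply: leq_trans h'].
Qed.

Fact starlike_display : Order.disp_t. Proof. exact: Order.Disp tt tt. Qed.

HB.instance Definition _ := Order.Le_isPOrder.Build starlike_display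
  (starlike a) starlike_le_refl starlike_le_anti starlike_le_trans.

Lemma starlike_le0x (u : starlike a) : (None : starlike a) <= u.
Proof. by []. Qed.

HB.instance Definition _ := Order.hasBottom.Build starlike_display
  (starlike a) starlike_le0x.

End StarlikeOrder.

Definition is_chain d (F : finPOrderType d) (X : {set F}) : bool :=
  [forall x in X, forall y in X, x >=< y].

(* Integer-valued: the empty poset has height -1, its only chain being the
   empty one. *)
Definition height d (F : finPOrderType d) (G : {set F}) : int :=
  ((\max_(X : {set F} | (X \subset G) && is_chain X) #|X|)%:Z - 1)%R.

Definition upset_in d (F : finPOrderType d) (G C : {set F}) : Prop :=
  forall x y : F, x \in C -> y \in G -> x <= y -> y \in C.

Definition has_partition d (F : finPOrderType d) (a : signature)
    (G : {set F}) : Prop :=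
  if sig_length a == 0%N then G = set0
  else exists C : 'I_(sig_length a) -> {set F},
    [/\ \bigcup_j C j = G,
        forall i j, i != j -> [disjoint C i & C j],
        forall j, upset_in G (C j)
      & forall j : 'I_(sig_length a),
          ((sig_nth a j)%:Z - 1 <= height (C j))%R].

Definition sig_connected d (F : finPOrderType d) (a : signature) : Prop :=
  ~ exists x : F, has_partition a [set y | x < y].

(* Main.v *)
(* A refutation of the Jankov-Fine formula of Q at x is the same thing as a
   p-morphism from the upset generated by x onto Q.  Such a p-morphism f
   onto T_a, taken at a maximal point x above which f takes the root value,
   splits the strict upset of x into the preimages of the branches, which are
   long enough by the back condition.  Conversely, given an a-partition of the
   strict upset of x, send x to the root and each y in the j-th block to the
   j-th branch, at distance min(depth y, a(j) - 1) from its top. *)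
Require Import Defs.
From mathcomp Require Import all_boot all_order.
From mathcomp Require Import ssralg ssrint zify.
From Stdlib Require Import Classical.

Set Implicit Arguments.
Unset Strict Implicit.
Unset Printing Implicit Defensive.
Import Order.TTheory.
Local Open Scope order_scope.

(** * Chains and depth in finite posets *)

Section ChainLength.
Variables (d : Order.disp_t) (F : finPOrderType d).
Implicit Types (x y z : F) (G X : {set F}).

Definition above x : {set F} := [set y | x < y].

(** The height plus one, kept in [nat], so the empty set gets 0. On [above y] it is the depth of
    [y], with maximal points at depth 0. *)
Definition chain_length G : nat :=
  \max_(X : {set F} | (X \subset G) && is_chain X) #|X|.

Lemma chain_length_ge G X : X \subset G -> is_chain X ->
  (#|X| <= chain_length G)%N.
Proof. by move=> sXG cX; apply: leq_bigmax_cond; rewrite sXG. Qed.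

Lemma chain_length_attained G :
  exists X, [/\ X \subset G, is_chain X & #|X| = chain_length G].
Proof.
have P0 : (set0 \subset G) && is_chain (set0 : {set F}).
  by rewrite sub0set; apply/forall_inP => x; rewrite inE.
have [X /andP[sXG cX] eX] := eq_bigmax_cond (fun X : {set F} => #|X|)
  (ltac:(by apply/card_gt0P; exists set0) :
     (0 < #|[pred X : {set F} | (X \subset G) && is_chain X]|)%N).
by exists X.
Qed.

(** A longest chain of [above y] can be extended downwards by [y]. *)
Lemma chain_length_above G y :
  y \in G -> above y \subset G -> (chain_length (above y) < chain_length G)%N.
Proof.
move=> yG sG; have [X [sX cX <-]] := chain_length_attained (above y).
have yX : y \notin X.
  by apply/negP => /(subsetP sX); rewrite inE ltxx.
have -> : #|X|.+1 = #|y |: X| by rewrite cardsU1 yX.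
apply: chain_length_ge.
  by rewrite subUset sub1set yG (subset_trans sX sG).
have ltX z : z \in X -> y < z by move/(subsetP sX); rewrite inE.
apply/forall_inP => u /setU1P[->|uX]; apply/forall_inP => v /setU1P[->|vX].
- exact: comparablexx.
- exact/lt_comparable/ltX.
- exact/gt_comparable/ltX.
- by have /forall_inP/(_ _ uX)/forall_inP/(_ _ vX) := cX.
Qed.

Lemma above_subset x y : x <= y -> above y \subset above x.
Proof. by move=> xy; apply/subsetP => z; rewrite !inE; apply: le_lt_trans. Qed.

Lemma chain_min X : is_chain X -> X != set0 ->
  exists2 m, m \in X & X :\ m \subset above m.
Proof.
move=> cX /set0Pn[x0 x0X].
(* The minimum is the point with the fewest elements of [X] below it: anything strictly below [m]
   would have fewer. *)
case: (arg_minnP (fun m => #|[set z in X | z <= m]|) x0X) => m mX minm.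
have {}mX : m \in X := mX; exists m => //; apply/subsetP => z /setD1P[zm zX]; rewrite inE.
have /forall_inP/(_ _ mX)/forall_inP/(_ _ zX) := cX.
case/orP=> [mz|zm']; first by rewrite lt_neqAle eq_sym zm.
suff : (#|[set u in X | u <= z]%O| < #|[set u in X | u <= m]%O|)%N.
  by rewrite ltnNge minm.
apply: proper_card; apply/properP; split.
  by apply/subsetP => u; rewrite !inE => /andP[-> /le_trans]; apply.
exists m; rewrite !inE mX ?lexx //=.
by apply/negP => mz; case/negP: zm; rewrite eq_le zm' mz.
Qed.

(** Depths skip no value. If [m] is the bottom of a longest chain of [G], removing it leaves a chain
    of length at least [k] in [above m]. So [m] has depth exactly [k], or the induction continues in
    the smaller set [above m]. *)
Lemma chain_length_lt G k :
  (forall y, y \in G -> above y \subset G) -> (k < chain_length G)%N ->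
  exists2 z, z \in G & chain_length (above z) = k.
Proof.
have [n] := ubnP #|G|; elim: n G => // n IHn G leGn upG ltk.
have [X [sX cX eX]] := chain_length_attained G.
have X0 : X != set0 by rewrite -card_gt0 eX (leq_ltn_trans _ ltk).
have [m mX sm] := chain_min cX X0; have mG := subsetP sX m mX.
have cXm : is_chain (X :\ m).
  apply/forall_inP => u /setD1P[_ uX]; apply/forall_inP => v /setD1P[_ vX].
  by have /forall_inP/(_ _ uX)/forall_inP/(_ _ vX) := cX.
have := chain_length_ge sm cXm; have := cardsD1 m X; rewrite mX eX => e.
have : (k <= #|X :\ m|)%N by move: ltk; rewrite e add1n ltnS.
move=> /leq_trans/[apply]; rewrite leq_eqVlt => /predU1P[->|ltkm].
  by exists m.
have [|y|z zm <-] := IHn (above m) _ _ ltkm.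
- rewrite -ltnS (leq_trans _ leGn) // ltnS proper_card //.
  by apply/properP; split; [exact: upG | exists m; rewrite ?inE ?ltxx].
- by rewrite inE => /ltW; apply: above_subset.
by exists z => //; apply: subsetP zm; apply: upG.
Qed.

End ChainLength.

(** * Refutations of the Jankov-Fine formula and p-morphisms *)

Section PMorphism.
Variables (d d' : Order.disp_t) (F : finPOrderType d) (Q : finBPOrderType d').
Implicit Types (U W : {set Q}) (q : Q).

(* p-morphism onto Q from the upset generated by x; the values of f outside
   this upset are irrelevant. *)
Definition rooted_pmorphism (x : F) (f : F -> Q) : Prop :=
  [/\ f x = \bot,
      forall y z, x <= y -> y <= z -> f y <= f z
    & forall y q, x <= y -> f y <= q -> exists2 z, y <= z & f z = q].

Lemma upsetP U : reflect (forall u v, u \in U -> u <= v -> v \in U) (upset U).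
Proof.
apply: (iffP forall_inP) => [h u v uU|h u uU].
  by move/forallP/(_ v)/implyP: (h u uU).
by apply/forallP => v; apply/implyP; apply: h.
Qed.

Lemma upset_impP U W q :
  reflect (forall u, q <= u -> u \in U -> u \in W) (q \in upset_imp U W).
Proof.
rewrite inE; apply: (iffP forallP) => h u.
  by move=> qu uU; move: (h u); rewrite qu uU.
by apply/implyP => qu; apply/implyP; apply: h.
Qed.

Lemma upsetI U W : upset U -> upset W -> upset (U :&: W).
Proof.
move=> /upsetP hU /upsetP hW; apply/upsetP => u v /setIP[uU uW] uv.
by apply/setIP; split; [apply: hU uU uv | apply: hW uW uv].
Qed.

Lemma upsetU U W : upset U -> upset W -> upset (U :|: W).
Proof.
move=> /upsetP hU /upsetP hW; apply/upsetP => u v /setUP[uU|uW] uv.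
  by apply/setUP; left; apply: hU uU uv.
by apply/setUP; right; apply: hW uW uv.
Qed.

Lemma upset_upset_imp U W : upset (upset_imp U W).
Proof.
apply/upsetP => u v /upset_impP h uv; apply/upset_impP => w vw.
exact/h/le_trans/vw.
Qed.

Lemma upset0 : upset (set0 : {set Q}).
Proof. by apply/upsetP => u v; rewrite inE. Qed.

Definition principal q : {set Q} := [set u | q <= u].

Lemma upset_principal q : upset (principal q).
Proof. by apply/upsetP => u v; rewrite !inE; apply: le_trans. Qed.

Lemma upset_nonbot : upset [set~ (\bot : Q)].
Proof.
apply/upsetP => u v; rewrite !inE => u0 uv.
by apply: contraNneq u0 => v0; rewrite -lex0 -v0.
Qed.

Lemma forces_bigand (V : nat -> F -> Prop) y (I : finType) (P : pred I)
    (p : I -> formula) :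
  forces V y (\big[And/Top]_(i | P i) p i) <->
  forall i, P i -> forces V y (p i).
Proof.
rewrite -big_filter.
have -> : (forall i, P i -> forces V y (p i)) <->
          (forall i, i \in [seq i <- index_enum I | P i] -> forces V y (p i)).
  by split=> h i; move: (h i); rewrite mem_filter mem_index_enum andbT.
elim: [seq _ <- _ | _] => [|i s IHs]; first by rewrite big_nil; split=> [_ j|_ z _ []].
rewrite big_cons /= IHs; split=> [[hi hs] j|h].
  by rewrite inE => /predU1P[->|/hs].
by split=> [|j js]; apply: h; rewrite inE ?eqxx ?js ?orbT.
Qed.

Lemma forces_diagram (V : nat -> F -> Prop) y :
  forces V y (upset_diagram Q) <->
  [/\ forall z, y <= z -> ~ V (enum_rank (set0 : {set Q})) z
    & forall U W, upset U -> upset W -> forall z, y <= z ->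
      [/\ V (enum_rank (U :&: W)) z <->
            V (enum_rank U) z /\ V (enum_rank W) z,
          V (enum_rank (U :|: W)) z <->
            V (enum_rank U) z \/ V (enum_rank W) z
        & V (enum_rank (upset_imp U W)) z <->
            forall t, z <= t -> V (enum_rank U) t -> V (enum_rank W) t]].
Proof.
rewrite /upset_diagram /=; split=> [[[h0 _] h]|[h0 h]].
  split=> [z yz|U W uU uW z yz]; first exact: h0.
  move: h; rewrite forces_bigand => /(_ U uU).
  rewrite forces_bigand => /(_ W uW) /= [[I1 I2] [[U1 U2] [M1 M2]]].
  by split; split=> hz; [exact: I1 | exact: I2 | exact: U1 | exact: U2
    | exact: M1 | exact: M2].
split; first by split=> z yz // /(h0 _ yz).
rewrite forces_bigand => U uU; rewrite forces_bigand => W uW /=.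
by split; [|split]; split=> z yz; have [hI hU hM] := h U W uU uW z yz; tauto.
Qed.

Lemma pmorphism_refutes x f :
  rooted_pmorphism x f -> ~ validates F (jankov_fine Q).
Proof.
case=> fx fmon fback.
(* The variable of [U] is made true on the preimage of [U], cut down to the upset of [x] because [f]
   is arbitrary elsewhere. *)
pose V (n : nat) y := x <= y /\ exists U, [/\ upset U, n = enum_rank U & f y \in U].
have Vp : persistent V.
  move=> n y z yz [xy [U [uU en fU]]]; split; first exact: le_trans yz.
  by exists U; split=> //; apply: (upsetP _ uU _ _ fU); apply: fmon.
have VE U y : upset U -> x <= y -> V (enum_rank U) y <-> f y \in U.
  move=> uU xy; split=> [[_ [W [_ /ord_inj/enum_rank_inj-> //]]]|fU].
  by split=> //; exists U.
move=> /(_ V Vp x) /= /(_ x (lexx x)); rewrite VE ?upset_nonbot //.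
rewrite fx !inE eqxx; move=> contra; suff : false by []; apply: contra.
apply/forces_diagram; split=> [z xz|U W uU uW z xz].
  by rewrite VE ?upset0 // inE.
split.
- by rewrite !VE ?upsetI // inE; split=> /andP.
- by rewrite !VE ?upsetU // inE; split=> /orP.
rewrite VE ?upset_upset_imp //; split=> [/upset_impP h t zt|h].
  have xt := le_trans xz zt; rewrite !VE //; apply: h; exact: fmon.
(* Only here is the back condition used: preimages commute with Heyting implication because each [u]
   above [f z] is attained above [z]. *)
apply/upset_impP => u fu uU'; have [t zt ft] := fback z u xz fu.
by have xt := le_trans xz zt; move: (h t zt); rewrite !VE // ft; apply.
Qed.

(** Forcing is [Prop]-valued; a boolean version, obtained classically, is what minimisation over a
    finite type requires. *)
Lemma finite_reflect (T : finType) (P : T -> Prop) :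
  exists p : pred T, forall t, P t <-> p t.
Proof.
apply: (@fin_all_exists T (fun _ => bool) (fun t b => P t <-> b)) => t.
by case: (classic (P t)) => h; [exists true | exists false].
Qed.

(** The value [f z] is the point generating the least upset forced at [z]. Persistence makes [f]
    monotone, the implication clauses give the back condition, and the failure of the consequent at
    [x] gives [f x = \bot]. *)
Lemma refutes_pmorphism (V : nat -> F -> Prop) x :
  persistent V -> forces V x (upset_diagram Q) ->
  ~ V (enum_rank [set~ (\bot : Q)]) x -> exists f, rooted_pmorphism x f.
Proof.
move=> Vp /forces_diagram[V0 VE] Vbot.
pose T U z := V (enum_rank U) z.
(* Primeness: the union clause is iterated along [s], and the empty union is excluded because [set0]
   is never forced. *)
have T_union (s : seq Q) z : x <= z -> T (\bigcup_(q <- s) principal q) z ->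
    exists2 q, q \in s & T (principal q) z.
  move=> xz; elim: s => [|q s IHs]; first by rewrite big_nil => /(V0 z xz).
  rewrite big_cons; have us : upset (\bigcup_(q <- s) principal q).
    elim/big_ind: _ => [|U W|i _]; [exact: upset0 | exact: upsetU |].
    exact: upset_principal.
  have [_ [hU _] _] := VE _ _ (upset_principal q) us z xz.
  case/hU => [Tq|/IHs[r rs Tr]]; first by exists q; rewrite ?mem_head.
  by exists r => //; rewrite inE rs orbT.
have T_point U z : x <= z -> upset U -> T U z ->
    exists2 q, q \in U & T (principal q) z.
  move=> xz uU TU.
  have eU : U = \bigcup_(q <- enum U) principal q.
    apply/setP => u; rewrite big_enum; apply/idP/bigcupP => [uU'|[q qU]].
      by exists u; rewrite ?inE.
    by rewrite inE; apply: (upsetP _ uU).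
  move: TU; rewrite {1}eU => /(T_union _ _ xz)[q]; rewrite mem_enum.
  by exists q.
(* The upsets forced at z form a prime filter, generated by one point. *)
have T_prime z : exists q, x <= z -> forall U, upset U -> (T U z <-> q \in U).
  case: (boolP (x <= z)) => [xz|]; last by exists \bot.
  have [p pE] := finite_reflect (fun q => T (principal q) z).
  (* [upset_imp set0 set0] is all of [Q], and its clause holds trivially; this supplies a first
     forced principal upset for the minimisation. *)
  have [q0 _ /pE q0p] : exists2 q, q \in upset_imp set0 set0 & T (principal q) z.
    apply: T_point => //; first exact: upset_upset_imp.
    by have [_ _ [_]] := VE _ _ upset0 upset0 z xz; apply.
  case: (arg_minnP (fun q => #|principal q|) q0p) => q /pE qp minq.
  exists q => _ U uU.
  have [[I1 I2] _ _] := VE _ _ (upset_principal q) uU z xz.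
  split=> [TU|qU].
    (* The intersection of [principal q] with [U] is forced, hence so is [principal r] for some [r]
       in it; minimality gives [principal r = principal q]. *)
    have [r /setIP[qr rU] /pE pr] :=
      T_point _ _ xz (upsetI (upset_principal q) uU) (I2 (conj qp TU)).
    rewrite inE in qr; suff : principal r = principal q.
      by move/setP/(_ q); rewrite !inE lexx => rq; apply: (upsetP _ uU r).
    apply/eqP; rewrite eqEcard minq // andbT.
    by apply/subsetP => u; rewrite !inE; apply: le_trans.
  have eq : principal q :&: U = principal q.
    apply/setIidPl/subsetP => u; rewrite inE; exact: (upsetP _ uU).
  by rewrite eq in I1; case: (I1 qp).
have [f fE] := @fin_all_exists F (fun _ => Q) _ T_prime.
exists f; split.
- apply/eqP/negPn/negP => fx0; apply: Vbot.
  by apply/(fE x (lexx x) _ upset_nonbot); rewrite !inE.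
- move=> y z xy yz; have up := upset_principal (f y).
  suff : f z \in principal (f y) by rewrite inE.
  apply/(fE z (le_trans xy yz) _ up); apply: Vp yz _.
  by apply/(fE y xy _ up); rewrite inE.
(* If no point above [y] were sent to [q], then [principal q] would imply [W] at [y], and evaluating
   this at [q] would put [q] in [W]. *)
move=> y q xy fyq; pose W := principal q :\ q.
have uW : upset W.
  apply/upsetP => u v; rewrite !inE => /andP[uq qu] uv.
  rewrite (le_trans qu uv) andbT; apply: contraNneq uq => vq.
  by rewrite eq_le qu -vq uv.
apply: NNPP => noz.
have [_ _ [_ hM]] := VE _ _ (upset_principal q) uW y xy.
have /(fE y xy _ (upset_upset_imp _ _))/upset_impP/(_ q fyq) :
    T (upset_imp (principal q) W) y.
  apply: hM => t yt; have xt := le_trans xy yt.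
  move/(fE t xt _ (upset_principal q)) => ft; apply/(fE t xt _ uW).
  by rewrite in_setD1 ft andbT; apply/eqP => ftq; apply: noz; exists t.
by rewrite !inE lexx eqxx => /(_ isT).
Qed.

Lemma validates_jankov_fine :
  validates F (jankov_fine Q) <-> ~ exists x f, rooted_pmorphism x f.
Proof.
split=> [v [x [f /pmorphism_refutes]] //|noF V Vp x y xy dy].
apply: NNPP => Vbot; apply: noF; exists y.
exact: refutes_pmorphism Vp dy Vbot.
Qed.

End PMorphism.

(** * Partitions of strict upsets and p-morphisms onto starlike trees *)

Lemma sig_nth_gt0 (a : signature) (j : 'I_(sig_length a)) :
  (0 < sig_nth a j)%N.
Proof.
have := ltn_ord j; rewrite /sig_nth {2}/sig_length => ltj.
case/andP: (valP a) => _ /allP pos.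
have : nth 0%N (flatten [seq nseq p.2 p.1 | p <- val a]) j
    \in flatten [seq nseq p.2 p.1 | p <- val a].
  apply: mem_nth; rewrite size_flatten /shape -map_comp.
  by rewrite (eq_map (g := snd)) // => p /=; rewrite size_nseq.
case/flatten_mapP => p /pos/andP[p1 _]; rewrite mem_nseq.
by case/andP => _ /eqP ->.
Qed.

Section Partition.
Variables (d : Order.disp_t) (F : finPOrderType d) (a : signature).
Implicit Types (x y z : F) (G : {set F}).

(** The empty signature needs no separate case: with no indices, the union is empty and forces
    [G = set0]. *)
Lemma has_partitionP G :
  has_partition a G <->
  exists C : 'I_(sig_length a) -> {set F},
    [/\ \bigcup_j C j = G,
        forall i j, i != j -> [disjoint C i & C j],
        forall j, upset_in G (C j)
      & forall j : 'I_(sig_length a), (sig_nth a j <= chain_length (C j))%N].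
Proof.
have hE j (X : {set F}) : (((sig_nth a j)%:Z - 1 <= height X) =
    (sig_nth a j <= chain_length X)%N)%R.
  by rewrite /height /chain_length; lia.
rewrite /has_partition; case: eqP => [l0|_]; last first.
  by split=> -[C [h1 h2 h3 h4]]; exists C; split=> // j; move: (h4 j);
    rewrite hE.
have no (j : 'I_(sig_length a)) : False by case: j => j; rewrite l0.
split=> [->|[C [<- _ _ _]]]; last by rewrite big1 // => j; case: (no j).
exists (fun _ => set0); split=> [|j||j]; try by case: (no j).
  by rewrite big1.
by move=> j; case: (no j).
Qed.

Lemma partition_pmorphism x :
  has_partition a (above x) ->
  exists f : F -> starlike a, rooted_pmorphism x f.
Proof.
case/has_partitionP => C [Ccov Cdis Cup Clen].
have Cx j y : y \in C j -> x < y.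
  move=> yC; suff : y \in above x by rewrite inE.
  by rewrite -Ccov; apply/bigcupP; exists j.
have Cinj i j y : y \in C i -> y \in C j -> i = j.
  move=> yi yj; apply/eqP/negPn/negP => /Cdis/disjointFr/(_ yi).
  by rewrite yj.
have Cle j y z : y \in C j -> y <= z -> z \in C j.
  move=> yC yz; apply: (Cup j y z yC _ yz).
  by rewrite inE (lt_le_trans (Cx _ _ yC)).
have Cabove j y : y \in C j -> above y \subset C j.
  by move=> yC; apply/subsetP => z; rewrite inE => /ltW; apply: Cle.
(* Levels count from the bottom of a branch. Truncated subtraction sends every depth [k] of at least
   [(sig_nth a j).-1] to level 0. *)
have posP (j : 'I_(sig_length a)) k : ((sig_nth a j).-1 - k < sig_nth a j)%N.
  by have := sig_nth_gt0 j; lia.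
pose pt j k : starlike a := Some (Tagged _ (Ordinal (posP j k))).
pose f y : starlike a :=
  if [pick j | y \in C j] is Some j then pt j (chain_length (above y)) else None.
have fC j y : y \in C j -> f y = pt j (chain_length (above y)).
  move=> yC; rewrite /f; case: pickP => [i yi|/(_ j)]; last by rewrite yC.
  by rewrite (Cinj i j y).
have fx : f x = None.
  by rewrite /f; case: pickP => // j /Cx; rewrite ltxx.
have Cex y : x <= y -> y = x \/ exists j, y \in C j.
  rewrite le_eqVlt => /predU1P[->|xy]; [by left | right].
  have : y \in above x by rewrite inE.
  by rewrite -Ccov => /bigcupP[j _ yC]; exists j.
(* Level [i] is reached by a point of depth [(sig_nth a j).-1 - i], which [chain_length_lt] finds in
   [G]. *)
have hit (j : 'I_(sig_length a)) (i : 'I_(sig_nth a j)) G :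
    (forall y, y \in G -> above y \subset G) -> G \subset C j ->
    ((sig_nth a j).-1 - i < chain_length G)%N ->
    exists2 z, z \in G & f z = Some (Tagged _ i).
  move=> Gup GC /(chain_length_lt Gup)[z zG ez]; exists z => //.
  rewrite (fC j) ?(subsetP GC) // ez; congr (Some (Tagged _ _)).
  by apply: val_inj => /=; have := ltn_ord i; lia.
exists f; split=> [|y z /Cex[->|[j yC]] yz|y [[j i]|] xy]; first exact: fx.
- by rewrite fx.
- have zC := Cle _ _ _ yC yz; rewrite (fC _ _ yC) (fC _ _ zC).
  apply/andP; split=> //=; apply: leq_sub2l.
  move: yz; rewrite le_eqVlt => /predU1P[-> //|yz].
  by apply/ltnW/chain_length_above; rewrite ?inE // above_subset // ltW.
- case: (Cex _ xy) => [->|[j' yC]].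
    move=> _; have [] := hit j i (C j) (@Cabove j) (subxx _).
      by apply: leq_trans (Clen j); have := sig_nth_gt0 j; lia.
    by move=> z /Cx/ltW; exists z.
  rewrite (fC _ _ yC) => /andP[/eqP /= ej]; case: _ / ej i => i /= lei.
  move: lei; set k := chain_length _ => lei.
  (* Either [y] is shallow enough, and [lei] then places it exactly at level [i], or the required
     depth occurs strictly above [y]. *)
  case: (leqP k ((sig_nth a j').-1 - i)) => ltk.
    exists y => //; rewrite (fC _ _ yC) -/k; congr (Some (Tagged _ _)).
    by apply: val_inj => /=; have := ltn_ord i; rewrite -/k; lia.
  have [|z yz fz] := hit j' i (above y) _ (Cabove _ _ yC) ltk.
    by move=> z; rewrite inE => /ltW; apply: above_subset.
  by exists z; rewrite // ltW //; move: yz; rewrite inE.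
- case: (Cex _ xy) => [->|[j yC]]; first by exists x.
  by rewrite (fC _ _ yC).
Qed.

Lemma pmorphism_partition x (f : F -> starlike a) :
  rooted_pmorphism x f -> exists y, has_partition a (above y).
Proof.
case=> fx0 fmon fback.
pose P y := (x <= y) && (f y == None).
have Px : P x by rewrite /P lexx fx0.
have [x' /andP[xx' /eqP fx'] max'] : exists2 x', (x <= x') && (f x' == None) &
    forall y, x' < y -> f y != None.
  (* A point with the smallest strict upset among those sent to the root is maximal among them. *)
  case: (arg_minnP (fun y => #|above y|) Px) => x' /andP[xx' fx'] minx.
  exists x' => [|y x'y]; first by rewrite xx'.
  apply/negP => fy; have := minx y; rewrite /P (le_trans xx' (ltW x'y)) fy.
  move=> /(_ isT); apply/negP; rewrite -ltnNge; apply: proper_card.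
  apply/properP; split; first exact/above_subset/ltW.
  by exists y; rewrite ?inE ?ltxx.
exists x'; apply/has_partitionP.
pose in_branch j (q : starlike a) := if q is Some p then tag p == j else false.
exists (fun j => [set y | (x' < y) && in_branch j (f y)]); split.
- apply/setP => y; rewrite inE; apply/bigcupP/idP => [[j _]|x'y].
    by rewrite inE => /andP[].
  have := max' y x'y; case fy: (f y) => [p|//] _.
  by exists (tag p); rewrite // inE x'y fy /= eqxx.
- move=> i j ij; apply/pred0P => y /=; rewrite !inE.
  case: (f y) => [p|] /=; last by rewrite !andbF.
  by apply: contraNF ij => /andP[/andP[_ /eqP <-] /andP[_ /eqP <-]].
- move=> j y z; rewrite !inE => /andP[x'y fy] x'z yz; rewrite x'z /=.
  have := fmon y z (le_trans xx' (ltW x'y)) yz.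
  case: (f y) fy => [p|//] /= /eqP <-; case: (f z) => [q|//] /= /andP[/eqP e _].
  by rewrite e.
move=> j; set C := [set y | _].
(* Climbing the branch: the back condition yields a point one level up, which is strictly larger
   because its image differs. *)
have len k y (i : 'I_(sig_nth a j)) : x <= y -> f y = Some (Tagged _ i) ->
    (i + k < sig_nth a j)%N -> (k <= chain_length (above y))%N.
  elim: k y i => // k IHk y i xy fy lti.
  have lti1 : (i.+1 < sig_nth a j)%N by lia.
  have [|z yz fz] := fback y (Some (Tagged _ (Ordinal lti1))) xy.
    by rewrite fy; apply/andP; split=> /=.
  have yz' : y < z.
    rewrite lt_neqAle yz andbT; apply/eqP => eyz.
    have : f z <= f y by rewrite eyz.
    by rewrite fz fy => /andP[_ /=]; rewrite ltnn.
  apply: leq_ltn_trans (IHk z _ (le_trans xy yz) fz _) _; first by rewrite /=; lia.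
  by apply: chain_length_above; rewrite ?inE // above_subset.
have n0 := sig_nth_gt0 j.
have [|y x'y fy] := fback x' (Some (Tagged _ (Ordinal n0))) xx'.
  by rewrite fx'.
have ltx'y : x' < y.
  by rewrite lt_neqAle x'y andbT; apply/eqP => e; move: fy; rewrite -e fx'.
(* From level 0 the climb gives only [(sig_nth a j).-1] points above [y]; [y] itself supplies the
   missing one. *)
have := len (sig_nth a j).-1 y _ (le_trans xx' x'y) fy; rewrite /= add0n.
move=> /(_ ltac:(by lia)) h; suff : (chain_length (above y) < chain_length C)%N.
  by lia.
apply: chain_length_above; first by rewrite inE ltx'y fy /= eqxx.
apply/subsetP => z; rewrite !inE => yz; rewrite (lt_trans ltx'y yz) /=.
have := fmon y z (le_trans xx' x'y) (ltW yz).
by rewrite fy; case: (f z) => [q|//] /andP[]; rewrite eq_sym.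
Qed.

End Partition.

Theorem theorem6p7 (d : Order.disp_t) (F : finPOrderType d) (a : signature) :
  validates F (jankov_fine (starlike a)) <-> sig_connected F a.
Proof.
rewrite validates_jankov_fine /sig_connected.
split=> h [x]; last by case=> f /pmorphism_partition.
by move/partition_pmorphism => [f fP]; apply: h; exists x, f.
Qed.
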